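(* If $G$ is a connected cubic graph of order $n$ that is not isomorphic to $K_4$, then $\gamma_{\rm gr}(G)\ge \frac{1}{2}n$, and the bound is sharp (that is, there exists a connected cubic graph $G\neq K_4$, of some order $n$, with $\gamma_{\rm gr}(G)=\frac{1}{2}n$).
   Context: Graphs are finite and simple; the order of a graph is its number of vertices; a cubic graph is a 3-regular graph. $N_G(v)$ is the set of neighbors of $v$ and $N_G[v]=N_G(v)\cup\{v\}$. A sequence $(v_1,\ldots,v_m)$ of vertices of $G$ is a closed neighborhood sequence if for every $i\in\{2,\ldots,m\}$, $N_G[v_i]\setminus\bigcup_{j=1}^{i-1}N_G[v_j]\neq\emptyset$. The Grundy domination number $\gamma_{\rm gr}(G)$ is the maximum length of a closed neighborhood sequence in $G$. *)

(* Defs.v *)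
From mathcomp Require Import all_boot.

Set Implicit Arguments.
Unset Strict Implicit.
Unset Printing Implicit Defensive.

Record sgraph := SGraph {
  vertex :> finType;
  adj : rel vertex;
  adj_sym : symmetric adj;
  adj_irrefl : irreflexive adj }.

Definition nbh (G : sgraph) (v : G) : {set G} := [set u | adj v u].

Definition cnbh (G : sgraph) (v : G) : {set G} := v |: nbh v.

Definition cubic (G : sgraph) : Prop := forall v : G, #|nbh v| = 3.

(* The graph without vertices is not considered connected. *)
Definition connected (G : sgraph) : Prop :=
  0 < #|G| /\ forall u v : G, connect (@adj G) u v.

Definition isomorphic (G H : sgraph) : Prop :=
  exists2 f : G -> H, bijective f & forall u v : G, adj (f u) (f v) = adj u v.

Definition complete_adj (n : nat) : rel 'I_n := fun i j => i != j.

Fact complete_sym n : symmetric (@complete_adj n).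
Proof. by move=> i j; rewrite /complete_adj eq_sym. Qed.

Fact complete_irrefl n : irreflexive (@complete_adj n).
Proof. by move=> i; rewrite /complete_adj eqxx. Qed.

Definition complete_graph (n : nat) : sgraph :=
  SGraph (@complete_sym n) (@complete_irrefl n).

(* Positions are numbered from 0, so [0 < i] exempts exactly the first vertex. *)
Definition closed_nbh_seq (G : sgraph) (m : nat) (s : m.-tuple G) : bool :=
  [forall i : 'I_m, (0 < i) ==>
     (cnbh (tnth s i) :\: \bigcup_(j < m | j < i) cnbh (tnth s j) != set0)].

(* Bounding the length by #|G| loses nothing: see [closed_nbh_seq_size] and
   [grundy_max]. *)
Definition grundy (G : sgraph) : nat :=
  \max_(m < #|G|.+1 | [exists s : m.-tuple G, closed_nbh_seq s]) m.

Lemma closed_nbh_seq_size (G : sgraph) m (s : m.-tuple G) :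
  closed_nbh_seq s -> m <= #|G|.
Proof.
move=> /forallP cs.
have neq (i j : 'I_m) : j < i -> tnth s i != tnth s j.
  move=> ltji; apply/eqP => eqs.
  have /set0Pn[x] := implyP (cs i) (leq_ltn_trans (leq0n j) ltji).
  rewrite inE => /andP[/negP xN xi]; apply: xN.
  by apply/bigcupP; exists j; rewrite // -eqs.
have inj : injective (tnth s).
  move=> i j eqs; apply: val_inj; case: (ltngtP i j) => // lt.
    by have := neq _ _ lt; rewrite eqs eqxx.
  by have := neq _ _ lt; rewrite eqs eqxx.
by rewrite -[m in m <= _]card_ord; exact: leq_card inj.
Qed.

Lemma grundy_max (G : sgraph) m (s : m.-tuple G) :
  closed_nbh_seq s -> m <= grundy G.
Proof.
move=> cs; have lem : m < #|G|.+1 by rewrite ltnS (closed_nbh_seq_size cs).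
rewrite /grundy (bigmax_sup (Ordinal lem)) //.
by apply/existsP; exists s.
Qed.

Lemma grundy_attained (G : sgraph) :
  exists s : (grundy G).-tuple G, closed_nbh_seq s.
Proof.
have P0 : [exists s : (@ord0 #|G|).-tuple G, closed_nbh_seq s].
  by apply/existsP; exists [tuple]; apply/forallP => -[].
pose P (m : 'I_#|G|.+1) := [exists s : m.-tuple G, closed_nbh_seq s].
have [|m Pm] := @eq_bigmax_cond _ P (@nat_of_ord _).
  by apply/card_gt0P; exists ord0.
by rewrite /grundy => ->; exact/existsP.
Qed.

(* Main.v *)
Require Import Defs.
From mathcomp Require Import all_boot all_order all_algebra zify.

(** The lower bound comes from a greedy construction.  Call a vertex dominated
    when it lies in the closed neighborhood of a vertex already picked.  As
    long as some vertex is undominated, connectivity gives a dominated [x]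
    with an undominated neighbor.  Such an [x] was not picked itself, so [x]
    and a picked neighbor of [x] are two dominated elements of the four-element
    set [N[x]]: picking [x] dominates one or two new vertices.  The first
    vertex dominates four, so a greedy sequence of length [m] that ends up
    dominating the whole graph has [n <= 4 + 2 (m - 1) = 2 m + 2].  As a cubic
    graph has even order ([cubic_even]), improving this by a single unit is
    enough, and a single step that dominates exactly one new vertex does so.

    If there is a triangle and the graph is not [K_4], such a step is available
    right after the first one ([triangle_new1]): otherwise the vertices of
    every triangle are pairwise twins, which makes some closed neighborhood a
    connected component isomorphic to [K_4].  If there is no triangle, consider
    a step [x] that dominates the last two undominated vertices [y] and [z]
    ([triangle_free_greedy_bound]).  Both are neighbors of [x], hence they are
    not adjacent, and picking [y] and then [z] instead of [x] gains one more
    vertex.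

    For sharpness, each vertex of a sequence dominates something new and the
    first dominates at least [delta + 1] vertices, where [delta] is the minimum
    degree; hence the Grundy domination number is at most [n - delta]
    ([grundy_le_min_degree]).  For [K_{3,3}] this is [3], half of its order. *)

Set Implicit Arguments.
Unset Strict Implicit.
Unset Printing Implicit Defensive.

Local Open Scope nat_scope.

(** * Dominated sets and closed neighborhood sequences *)

Definition dominated (G : sgraph) (s : seq G) : {set G} :=
  \bigcup_(v <- s) cnbh v.

(** The most recently picked vertex comes first, so that extending a sequence
    is a [cons].  No exception is made for the first picked vertex: a closed
    neighborhood is never empty. *)
Fixpoint legal (G : sgraph) (s : seq G) : bool :=
  if s is v :: s' then ~~ (cnbh v \subset dominated s') && legal s' else true.

Definition triangle_free (G : sgraph) : Prop :=
  forall u v w : G, adj u v -> adj v w -> adj u w = false.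

Lemma in_cnbh (G : sgraph) (u v : G) : (u \in cnbh v) = (u == v) || adj v u.
Proof. by rewrite !inE. Qed.

Lemma cnbh_refl (G : sgraph) (v : G) : v \in cnbh v.
Proof. by rewrite in_cnbh eqxx. Qed.

Lemma cnbh_sym (G : sgraph) (u v : G) : (u \in cnbh v) = (v \in cnbh u).
Proof. by rewrite !in_cnbh eq_sym adj_sym. Qed.

Lemma card_cnbh (G : sgraph) (v : G) : #|cnbh v| = #|nbh v|.+1.
Proof. by rewrite /cnbh cardsU1 inE adj_irrefl. Qed.

Lemma cubic_card_cnbh (G : sgraph) (v : G) : cubic G -> #|cnbh v| = 4.
Proof. by move=> cub; rewrite card_cnbh cub. Qed.

Lemma dominated_nil (G : sgraph) : dominated (Nil G) = set0.
Proof. by rewrite /dominated big_nil. Qed.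

Lemma dominated_cons (G : sgraph) (v : G) s :
  dominated (v :: s) = cnbh v :|: dominated s.
Proof. by rewrite /dominated big_cons. Qed.

Lemma dominated1 (G : sgraph) (v : G) : dominated [:: v] = cnbh v.
Proof. by rewrite dominated_cons dominated_nil setU0. Qed.

Lemma dominatedP (G : sgraph) (s : seq G) x :
  reflect (exists2 v, v \in s & x \in cnbh v) (x \in dominated s).
Proof.
elim: s => [|v s IHs].
  by rewrite dominated_nil inE; apply: ReflectF => -[].
rewrite dominated_cons in_setU; apply: (iffP orP) => [[xv|/IHs[w ws xw]]|].
- by exists v; rewrite ?mem_head.
- by exists w; rewrite // inE ws orbT.
case=> w; rewrite inE => /predU1P[->|ws] xw; first by left.
by right; apply/IHs; exists w.
Qed.

Lemma dominated_rev (G : sgraph) (s : seq G) : dominated (rev s) = dominated s.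
Proof.
apply/setP => x; apply/dominatedP/dominatedP => -[v vs xv]; exists v => //.
  by rewrite mem_rev in vs.
by rewrite mem_rev.
Qed.

Lemma card_dominated_cons (G : sgraph) (v : G) s :
  #|dominated (v :: s)| = #|cnbh v :\: dominated s| + #|dominated s|.
Proof.
rewrite dominated_cons cardsU cardsD.
have := subset_leq_card (subsetIl (cnbh v) (dominated s)); lia.
Qed.

Lemma legal1 (G : sgraph) (v : G) : legal [:: v].
Proof.
rewrite /= andbT dominated_nil subset0; apply/set0Pn.
by exists v; apply: cnbh_refl.
Qed.

(** The positional form of [legal], to be compared with the definition of
    closed neighborhood sequences by positions in a tuple. *)
Lemma legalP (G : sgraph) (s : seq G) (x0 : G) :
  reflect (forall i, i < size s ->
             ~~ (cnbh (nth x0 s i) \subset dominated (drop i.+1 s)))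
          (legal s).
Proof.
elim: s => [|v s IHs] /=; first exact: ReflectT.
apply: (iffP andP) => [[vN /IHs leg] [|i]|leg] /=.
- by rewrite drop0.
- exact: leg.
by split; [have := leg 0 isT; rewrite /= drop0 | apply/IHs => i; apply: (leg i.+1)].
Qed.

Lemma bigcup_tnth_take (G : sgraph) m (s : m.-tuple G) (i : nat) :
  \bigcup_(j < m | j < i) cnbh (tnth s j) = dominated (take i s).
Proof.
apply/setP => x; apply/bigcupP/dominatedP => [[j ltji xj]|[v]].
  exists (tnth s j) => //; rewrite (tnth_nth x) -(nth_take _ ltji) mem_nth //.
  by rewrite size_take size_tuple; case: ifP; rewrite ?ltji.
move=> /(nthP x)[j]; rewrite size_take_min leq_min size_tuple => /andP[ltji ltjm].
by rewrite nth_take // => <- xj; exists (Ordinal ltjm); rewrite // (tnth_nth x).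
Qed.

Lemma closed_nbh_seq_legal (G : sgraph) m (s : m.-tuple G) :
  closed_nbh_seq s = legal (rev s).
Proof.
case: m s => [|m] s; first by rewrite tuple0; apply/forallP => -[].
have x0 := tnth s ord0.
apply/forallP/(legalP _ x0) => [closed i|leg i]; last first.
  apply/implyP => _; rewrite bigcup_tnth_take setD_eq0.
  have lti : m - i < size (rev s) by rewrite size_rev size_tuple; lia.
  have := leg _ lti; rewrite nth_rev ?drop_rev; last by rewrite -size_rev.
  rewrite dominated_rev size_tuple (tnth_nth x0).
  have lei := ltn_ord i.
  have -> : m.+1 - (m - i).+1 = i by lia.
  by [].
rewrite size_rev size_tuple => lti.
rewrite nth_rev ?drop_rev ?size_tuple // dominated_rev.
have ltj : m.+1 - i.+1 < m.+1 by lia.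
(* The closed neighborhood condition exempts position 0, where [legal] asks
   that a closed neighborhood be nonempty; hence the case analysis below. *)
have := closed (Ordinal ltj); rewrite bigcup_tnth_take (tnth_nth x0) /= setD_eq0.
case: (m.+1 - i.+1) {ltj} => [_|j]; last by [].
rewrite take0 dominated_nil subset0; apply/set0Pn.
by exists (nth x0 s 0); apply: cnbh_refl.
Qed.

Lemma legal_size_grundy (G : sgraph) (s : seq G) : legal s -> size s <= grundy G.
Proof.
move=> leg; rewrite -(size_rev s); apply: (grundy_max (s := in_tuple (rev s))).
by rewrite closed_nbh_seq_legal revK.
Qed.

Lemma legal_attained (G : sgraph) :
  exists2 s : seq G, legal s & size s = grundy G.
Proof.
have [s] := grundy_attained G; rewrite closed_nbh_seq_legal => leg.
by exists (rev s); rewrite // size_rev size_tuple.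
Qed.

(** * Greedy extension *)

Lemma frontier (G : sgraph) (A : {set G}) :
    connected G -> A != set0 -> A != setT ->
  exists x y, [/\ x \in A, y \notin A & adj x y].
Proof.
move=> [_ conn] /set0Pn[a aA] AnT.
case: (pickP [pred p : G * G | [&& p.1 \in A, p.2 \notin A & adj p.1 p.2]]).
  by move=> [x y] /and3P[xA yA xy]; exists x, y.
move=> no; case/negP: AnT; apply/eqP/setP => b; rewrite inE.
have closA : closed (@adj G) (mem A).
  apply: intro_closed; first exact/sym_connect_sym/adj_sym.
  by move=> x y xy xA; have := no (x, y); rewrite /= xA xy andbT => /negbFE.
by rewrite -(closed_connect closA (conn a b)).
Qed.

(** A vertex with an undominated neighbor was not picked itself, so if it is
    dominated, it is so through a picked neighbor [v]; then [x] and [v] are two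
    elements of [cnbh x] that bring nothing new. *)
Lemma dominated_new_le2 (G : sgraph) (s : seq G) x y :
    cubic G -> x \in dominated s -> y \notin dominated s -> adj x y ->
  #|cnbh x :\: dominated s| <= 2.
Proof.
move=> cub xD yD xy; have [v vs xv] := dominatedP _ _ xD.
have vD z : z \in cnbh v -> z \in dominated s.
  by move=> zv; apply/dominatedP; exists v.
have vx : v != x.
  by apply: contraNneq yD => vx; apply: vD; rewrite vx in_cnbh xy orbT.
have sub : [set x; v] \subset cnbh x :&: dominated s.
  apply/subsetP => z /set2P[]->; rewrite inE ?xD ?andbT ?cnbh_refl //.
  by rewrite cnbh_sym xv vD ?cnbh_refl.
have := subset_leq_card sub; rewrite cards2 eq_sym vx cardsD cubic_card_cnbh //=.
lia.
Qed.

Lemma greedy_step (G : sgraph) (s : seq G) :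
    connected G -> cubic G -> s != [::] -> legal s -> dominated s != setT ->
  exists x, [/\ x \in dominated s, legal (x :: s) &
    0 < #|cnbh x :\: dominated s| <= 2].
Proof.
move=> conn cub sN leg DnT.
have Dn0 : dominated s != set0.
  case: s sN {leg DnT} => // v s _; apply/set0Pn; exists v.
  by rewrite dominated_cons in_setU cnbh_refl.
have [x [y [xD yD xy]]] := frontier conn Dn0 DnT.
have yx : y \in cnbh x :\: dominated s by rewrite inE yD in_cnbh xy orbT.
exists x; split=> //=.
  by rewrite leg andbT -setD_eq0; apply/set0Pn; exists y.
rewrite (dominated_new_le2 cub xD yD xy) andbT.
by apply/card_gt0P; exists y.
Qed.

(** The defect [#|dominated s| - 2 * size s] does not increase along greedy
    steps, so a bound [k] on it at any moment is still valid when everything is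
    dominated. *)
Lemma greedy_bound (G : sgraph) (s : seq G) k :
    connected G -> cubic G -> s != [::] -> legal s ->
    #|dominated s| <= 2 * size s + k ->
  #|G| <= 2 * grundy G + k.
Proof.
move=> conn cub; have [N] := ubnP #|~: dominated s|; elim: N s => // N IHN s.
move=> leN sN leg bnd; have [DT|DnT] := eqVneq (dominated s) setT.
  have := legal_size_grundy leg; move: bnd; rewrite DT cardsT; lia.
have [x [xD legx /andP[new_gt0 new_le2]]] := greedy_step conn cub sN leg DnT.
have eqD := card_dominated_cons x s.
have cs := cardsC (dominated s); have cx := cardsC (dominated (x :: s)).
apply: (IHN (x :: s)) => //; first lia.
move: eqD bnd => /=; lia.
Qed.

(** In a triangle-free graph the greedy construction always gains at least one
    unit: either some step dominates a single new vertex, or the last step,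
    which dominates two vertices, can be replaced by two steps. *)
Lemma triangle_free_greedy_bound (G : sgraph) (s : seq G) k :
    connected G -> cubic G -> triangle_free G -> s != [::] -> legal s ->
    dominated s != setT -> #|dominated s| <= 2 * size s + k.+1 ->
  #|G| <= 2 * grundy G + k.
Proof.
move=> conn cub tf; have [N] := ubnP #|~: dominated s|; elim: N s => // N IHN s.
move=> leN sN leg DnT bnd.
have [x [xD legx /andP[new_gt0 new_le2]]] := greedy_step conn cub sN leg DnT.
have eqD := card_dominated_cons x s.
have [new1|new2] : #|cnbh x :\: dominated s| = 1 \/ #|cnbh x :\: dominated s| = 2.
- by lia.
- by apply: (@greedy_bound _ (x :: s)) => //; move: eqD bnd => /=; lia.
have [xT|xnT] := eqVneq (dominated (x :: s)) setT; last first.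
  have cs := cardsC (dominated s); have cx := cardsC (dominated (x :: s)).
  apply: (IHN (x :: s)) => //; first lia.
  by move: eqD bnd => /=; lia.
(* [x] would finish the construction by dominating [y] and [z]: pick [y] and
   [z] themselves instead. *)
have /cards2P[y [z [yz newE]]] : #|cnbh x :\: dominated s| == 2 by apply/eqP.
have new_adj w : w \in [set y; z] -> w \notin dominated s /\ adj x w.
  rewrite -newE inE in_cnbh => /andP[wD /predU1P[wx|xw]]; last by [].
  by rewrite wx xD in wD.
have [yD xy] := new_adj y (set21 y z); have [zD xz] := new_adj z (set22 y z).
have zy : z \notin cnbh y.
  apply/negP; rewrite in_cnbh eq_sym (negPf yz) /= => adjyz.
  by rewrite (tf _ _ _ xy adjyz) in xz.
have leg2 : legal [:: z, y & s].
  rewrite /= leg andbT; apply/andP; split; apply/subsetPn.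
    by exists z; rewrite ?cnbh_refl // dominated_cons in_setU (negPf zy).
  by exists y; rewrite ?cnbh_refl.
have := legal_size_grundy leg2; move: eqD bnd; rewrite xT cardsT new2 /=; lia.
Qed.

(** * Triangles *)

Lemma cnbh_stable_full (G : sgraph) (v : G) :
  connected G -> (forall w, w \in cnbh v -> cnbh w = cnbh v) -> cnbh v = setT.
Proof.
move=> conn eqN; apply/eqP/negPn/negP => NnT.
have Nn0 : cnbh v != set0 by apply/set0Pn; exists v; apply: cnbh_refl.
have [x [y [xN yN xy]]] := frontier conn Nn0 NnT.
by case/negP: yN; rewrite -(eqN x xN) in_cnbh xy orbT.
Qed.

Lemma isomorphic_complete (G : sgraph) (n : nat) :
    #|G| = n -> (forall v : G, cnbh v = setT) ->
  isomorphic G (complete_graph n).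
Proof.
move=> <- full; exists (@enum_rank G); first exact: enum_rank_bij.
move=> u v; rewrite /= /complete_adj (inj_eq enum_rank_inj).
have := in_setT v; rewrite -(full u) in_cnbh eq_sym.
by case: eqVneq => [->|_] //=; rewrite adj_irrefl.
Qed.

(** The closed neighborhoods of two vertices of a triangle have four elements
    and share three, so they differ by exactly one vertex or coincide.  If they
    always coincide, all vertices of [cnbh u] turn out to be twins of [u]: each
    neighbor of [u] other than [v] is adjacent to the twin [v] of [u], hence
    forms a triangle with [u] and [v].  Then [cnbh u] is a clique closed under
    adjacency, that is, the whole graph. *)
Lemma triangle_new1 (G : sgraph) (u v w : G) :
    connected G -> cubic G -> ~ isomorphic G (complete_graph 4) ->
    adj u v -> adj v w -> adj u w ->
  exists a b : G, #|cnbh a :\: cnbh b| = 1.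
Proof.
move=> conn cub notK4 uv vw uw.
case: (pickP [pred p : G * G | #|cnbh p.1 :\: cnbh p.2| == 1]).
  by move=> [a b] /eqP; exists a, b.
move=> no1; case: notK4.
have neq (x y : G) : adj x y -> x != y.
  by apply: contraTneq => ->; rewrite adj_irrefl.
have twins (a b c : G) : adj a b -> adj b c -> adj a c -> cnbh b = cnbh a.
  move=> ab bc ac; apply/eqP; rewrite eqEcard !cubic_card_cnbh // leqnn andbT.
  have sub : [set a; b; c] \subset cnbh b :&: cnbh a.
    apply/subsetP => z; rewrite in_setI !in_cnbh !inE -orbA.
    by case/or3P => /eqP->; rewrite ?eqxx ?ab ?bc ?ac ?(adj_sym b a) ?ab ?orbT.
  have := subset_leq_card sub; have /= := no1 (b, a).
  rewrite -setD_eq0 -cards_eq0 cardsD cubic_card_cnbh // setUC cardsU1 cards2.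
  rewrite !inE (neq a b ab) (eq_sym c a) (negPf (neq a c ac)).
  rewrite (eq_sym c b) (negPf (neq b c bc)) /=; lia.
have Nv := twins u v w uv vw uw.
have stable x : x \in cnbh u -> cnbh x = cnbh u.
  move=> xu; have [->|xv] := eqVneq x v; first by [].
  have [->|xnu] := eqVneq x u; first by [].
  have: adj v x by move: xu; rewrite -Nv in_cnbh (negPf xv).
  have: adj u x by move: xu; rewrite in_cnbh (negPf xnu).
  by move=> ux vx; apply: (twins u x v) => //; rewrite adj_sym.
have full := cnbh_stable_full conn stable.
apply: isomorphic_complete; first by rewrite -cardsT -full cubic_card_cnbh.
by move=> x; rewrite stable // full inE.
Qed.

(** * Parity of the order and the lower bound *)

(** Exchanging the two ends of an arc pairs the arcs going up in the enumeration
    of the vertices with those going down. *)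
Lemma even_sum_degree (G : sgraph) : odd (\sum_(v : G) #|nbh v|) = false.
Proof.
pose r (p : G * G) := (enum_rank p.1 < enum_rank p.2).
pose swap (p : G * G) := (p.2, p.1).
have -> : \sum_(v : G) #|nbh v| = \sum_(p : G * G | adj p.1 p.2) 1.
  rewrite (eq_bigr (fun v : G => \sum_(w : G | adj v w) 1)).
    by rewrite pair_big_dep.
  by move=> v _; rewrite -sum1_card; apply: eq_bigl => w; rewrite inE.
rewrite (bigID r) /= [X in _ + X](reindex_inj (h := swap)) /=; last first.
  by move=> [a b] [c d] [-> ->].
rewrite [X in _ + X](eq_bigl (fun p => adj p.1 p.2 && r p)).
  by rewrite addnn odd_double.
move=> [a b]; rewrite /r /= adj_sym -leqNgt leq_eqVlt.
case ab: (adj a b) => //=; case: eqP => // /val_inj/enum_rank_inj eqab.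
by rewrite eqab adj_irrefl in ab.
Qed.

Lemma cubic_even (G : sgraph) : cubic G -> odd #|G| = false.
Proof.
move=> cub; have := even_sum_degree G; rewrite (eq_bigr (fun => 3)) //.
by rewrite sum_nat_const oddM andbT.
Qed.

Lemma cubic_grundy_ge (G : sgraph) :
    connected G -> cubic G -> ~ isomorphic G (complete_graph 4) ->
  #|G| <= 2 * grundy G.
Proof.
move=> conn cub notK4.
suff: #|G| <= 2 * grundy G + 1 by have := cubic_even cub; lia.
case: (pickP [pred p : G * G * G |
   [&& adj p.1.1 p.1.2, adj p.1.2 p.2 & adj p.1.1 p.2]]).
  move=> [[u v] w] /and3P[/= uv vw uw].
  have [a [b ab]] := triangle_new1 conn cub notK4 uv vw uw.
  apply: (@greedy_bound _ [:: a; b]) => //.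
    have := legal1 b; rewrite /= => ->; rewrite andbT dominated1.
    by rewrite -setD_eq0 -cards_eq0 ab.
  by rewrite card_dominated_cons dominated1 ab cubic_card_cnbh.
move=> no3; have tf : triangle_free G.
  by move=> u v w uv vw; have /= := no3 (u, v, w); rewrite uv vw.
have [/card_gt0P[v _] _] := conn.
apply: (@triangle_free_greedy_bound _ [:: v]) => //; first exact: legal1.
  apply/eqP; rewrite dominated1 => NT.
  have card4 : #|G| = 4 by rewrite -cardsT -NT cubic_card_cnbh.
  case: notK4; apply: isomorphic_complete => // x.
  by apply/eqP; rewrite eqEcard subsetT cardsT card4 cubic_card_cnbh.
by rewrite dominated1 cubic_card_cnbh.
Qed.

(** * An upper bound and its equality case *)

Lemma legal_card_dominated (G : sgraph) (s : seq G) d :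
    (forall v : G, d <= #|nbh v|) -> s != [::] -> legal s ->
  size s + d <= #|dominated s|.
Proof.
move=> deg; elim: s => // v [|w s] IHs _.
  by move=> _; rewrite dominated1 card_cnbh add1n ltnS.
move=> /andP[vN leg]; rewrite card_dominated_cons.
have := IHs isT leg; have : 0 < #|cnbh v :\: dominated (w :: s)|.
  by rewrite card_gt0 setD_eq0.
move=> /=; lia.
Qed.

Lemma grundy_le_min_degree (G : sgraph) d :
  0 < #|G| -> (forall v : G, d <= #|nbh v|) -> grundy G + d <= #|G|.
Proof.
move=> /card_gt0P[v _] deg; have [s leg <-] := legal_attained G.
have [->|sN] := eqVneq s [::]; first exact: leq_trans (deg v) (max_card _).
exact: leq_trans (legal_card_dominated deg sN leg) (max_card _).
Qed.

Definition K33_adj : rel (bool * 'I_3) := fun u v => u.1 != v.1.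

Fact K33_sym : symmetric K33_adj.
Proof. by move=> u v; rewrite /K33_adj eq_sym. Qed.

Fact K33_irrefl : irreflexive K33_adj.
Proof. by move=> u; rewrite /K33_adj eqxx. Qed.

Definition K33 : sgraph := SGraph K33_sym K33_irrefl.

Lemma K33_card : #|K33| = 6.
Proof. by rewrite card_prod card_bool card_ord. Qed.

Lemma K33_cubic : cubic K33.
Proof.
move=> [b i]; rewrite -[RHS](_ : #|setX [set ~~ b] [set: 'I_3]| = 3).
  apply: eq_card => -[c j]; rewrite !inE andbT /= /K33_adj /=.
  by case: b; case: c.
by rewrite cardsX cards1 cardsT card_ord.
Qed.

Lemma K33_connected : connected K33.
Proof.
split=> [|u v]; first by rewrite K33_card.
have [eq1|neq1] := eqVneq u.1 v.1; last exact/connect1.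
apply: (connect_trans (y := (~~ u.1, u.2))); apply: connect1.
  by rewrite /= /K33_adj /=; case: u.1.
by rewrite /= /K33_adj /= eq1; case: v.1.
Qed.

Lemma K33_not_K4 : ~ isomorphic K33 (complete_graph 4).
Proof.
by case=> f /bij_eq_card; rewrite K33_card card_ord.
Qed.

Lemma K33_grundy : grundy K33 = 3.
Proof.
have := cubic_grundy_ge K33_connected K33_cubic K33_not_K4.
have := @grundy_le_min_degree K33 3; rewrite K33_card => /(_ isT).
have deg (v : K33) : 3 <= #|nbh v| by rewrite K33_cubic.
by move=> /(_ deg); lia.
Qed.

Local Open Scope ring_scope.

Theorem corollary2p2 :
  (forall (G : sgraph) (n : nat),
      #|G| = n -> connected G -> cubic G -> ~ isomorphic G (complete_graph 4) ->
      n%:R / 2%:R <= (grundy G)%:R :> rat)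
  /\ (exists (G : sgraph) (n : nat),
      [/\ #|G| = n, connected G, cubic G, ~ isomorphic G (complete_graph 4)
        & (grundy G)%:R = n%:R / 2%:R :> rat]).
Proof.
split=> [G n <- conn cub notK4|].
  rewrite Num.Theory.ler_pdivrMr // -GRing.natrM Num.Theory.ler_nat mulnC.
  exact: cubic_grundy_ge.
exists K33, 6; split; rewrite ?K33_card ?K33_grundy //.
- exact: K33_connected.
- exact: K33_cubic.
- exact: K33_not_K4.
Qed.
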